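(* Let $\mathbb{X}$ be a tangent category with negatives, let $K: T^2(M)\to T(M)$ be a torsion-free affine vertical connection on an object $M$ (torsion-free means $c_MK=K$), and let $C := c_{T(M)}T(K)K - T(K)K : T^3(M)\to T(M)$ be its curvature. Then: (i) (Anti-symmetry) $cC=-C$, where $c=c_{T(M)}$; (ii) (First Bianchi identity) $C + c\,T(c)\,C + T(c)\,c\,C = 0$, where $c=c_{T(M)}$ and $T(c)=T(c_M)$; (iii) (Second Bianchi identity) $D_K(C) + T(c)T^2(c)D_K(C) + T^2(c)T(c)D_K(C)=0$, where $D_K(C):=T(C)K: T^4(M)\to T(M)$, $T(c)=T(c_{T(M)})$ and $T^2(c)=T^2(c_M)$. Here sums, differences and negatives of maps into $T(M)$ are taken in the fibrewise abelian group $p_M:T(M)\to M$, and $0$ denotes the zero with the appropriate base point, i.e. the map to $M$ given by the iterated projection $p$ followed by $0_M$.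
   Context: Conventions: composites are written in diagrammatic order ($fg$ means first $f$, then $g$). $\langle f,g\rangle$ is the induced map into a pullback, with projections $\pi_0,\pi_1$. Component subscripts of natural transformations are often omitted. An additive bundle over $M$ is a map $q:E\to M$ whose finite wide pullbacks $E_n$ along itself exist, with maps $+_q:E_2\to E$, $0_q:M\to E$ making $q$ a commutative monoid in the slice over $M$. An additive bundle morphism $(f_1,f_0)$ from $q:E\to M$ to $q':E'\to M'$ is a pair $f_1:E\to E'$, $f_0:M\to M'$ with $f_1q'=qf_0$ preserving addition and zero. A tangent category is a category with a functor $T$ and natural transformations $p:T\to 1$, $0:1\to T$, $+:T_2\to T$, $\ell:T\to T^2$, $c:T^2\to T^2$ such that: each $(p_M,+_M,0_M)$ is an additive bundle, the wide pullbacks $T_nM$ of $p_M$ exist and are preserved by each $T^k$; $(\ell_M,0_M)$ is an additive bundle morphism from $(p_M,+_M,0_M)$ to $(T(p_M),T(+_M),T(0_M))$; $(c_M,1)$ is an additive bundle morphism from $(T(p_M),T(+_M),T(0_M))$ to $(p_{TM},+_{TM},0_{TM})$; $c^2=1$, $\ell c=\ell$, $\ell_M\ell_{TM}=\ell_MT(\ell_M)$, $T(c)cT(c)=cT(c)c$, $\ell_{TM}T(c_M)c_{TM}=c_MT(\ell_M)$; and the square with top $\langle\pi_0\ell,\pi_10\rangle T(+):T_2M\to T^2M$, left $\pi_0p=\pi_1p:T_2M\to M$, right $T(p):T^2M\to TM$, bottom $0_M$ is a pullback preserved by each $T^k$. It has negatives if there is a natural transformation $n:T\to T$ making each $p_M$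 a fibrewise abelian group; then $f-g:=\langle f,gn\rangle+$ for maps $f,g$ into $T(M)$ with $fp=gp$. An affine vertical connection on $M$ is a map $K:T^2(M)\to T(M)$ with $\ell_MK=1$, $Kp=pp$, $K\ell_M=\ell_{TM}T(K)$ and $K\ell_M=T(\ell_M)c_{TM}T(K)$ (equivalently, $K$ retracts $\ell_M$ and is a linear bundle morphism for both bundle structures $T(p_M)$ and $p_{TM}$ on $T^2(M)$). *)

(* Defs.v *)
From mathcomp Require Import all_boot.

Set Implicit Arguments.
Unset Strict Implicit.
Unset Printing Implicit Defensive.

Reserved Notation "f ;; g" (at level 40, left associativity).

(* Composition is written in diagrammatic order: [f ;; g] is first f, then g. *)
Record category := Category {
  ob :> Type;
  hom : ob -> ob -> Type;
  idm : forall A, hom A A;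
  comp : forall A B C, hom A B -> hom B C -> hom A C;
  comp1m : forall A B (f : hom A B), comp (idm A) f = f;
  compm1 : forall A B (f : hom A B), comp f (idm B) = f;
  compA : forall A B C D (f : hom A B) (g : hom B C) (h : hom C D),
    comp f (comp g h) = comp (comp f g) h }.
Arguments hom {c}.
Arguments idm {c}.
Notation "f ;; g" := (comp f g).

Record endofunctor (X : category) := Endofunctor {
  fobj :> X -> X;
  fmap : forall A B : X, hom A B -> hom (fobj A) (fobj B);
  fmap1 : forall A, fmap (idm A) = idm (fobj A);
  fmapM : forall (A B C : X) (f : hom A B) (g : hom B C),
    fmap (f ;; g) = fmap f ;; fmap g }.
Arguments fmap {X} e {A B}.

Definition fid (X : category) : endofunctor X :=
  @Endofunctor X (fun A => A) (fun A B f => f)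
    (fun A => erefl) (fun A B C f g => erefl).

Section Power.
Variables (X : category) (F G : endofunctor X).

Let fcomp_map A B (f : hom A B) := fmap G (fmap F f).
Fact fcomp1 A : fcomp_map (idm A) = idm (G (F A)).
Proof. by rewrite /fcomp_map !fmap1. Qed.
Fact fcompM (A B C : X) (f : hom A B) (g : hom B C) :
  fcomp_map (f ;; g) = fcomp_map f ;; fcomp_map g.
Proof. by rewrite /fcomp_map !fmapM. Qed.
Definition fcomp : endofunctor X := Endofunctor fcomp1 fcompM.
End Power.

Fixpoint fpow (X : category) (F : endofunctor X) (k : nat) : endofunctor X :=
  if k is k'.+1 then fcomp (fpow F k') F else fid X.

(* The wide pullback of n copies of q : E -> M.  The leg P -> M is part of the
   cone, so that for n = 0 this is M itself.  The mediating map is recorded as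
   an operation; it is uniquely determined. *)
Record is_wide_pullback (X : category) (E M : X) (q : hom E M) (n : nat)
    (P : X) (base : hom P M) (proj : 'I_n -> hom P E) := IsWidePullback {
  wp_comm : forall i, proj i ;; q = base;
  wp_lift : forall (Y : X) (b : hom Y M) (f : 'I_n -> hom Y E),
    (forall i, f i ;; q = b) -> hom Y P;
  wp_lift_base : forall Y b f H, @wp_lift Y b f H ;; base = b;
  wp_lift_proj : forall Y b f H i, @wp_lift Y b f H ;; proj i = f i;
  wp_unique : forall (Y : X) (h h' : hom Y P),
    h ;; base = h' ;; base -> (forall i, h ;; proj i = h' ;; proj i) -> h = h' }.

Record wide_pullback (X : category) (E M : X) (q : hom E M) (n : nat) :=
  WidePullback {
    wp_ob :> X;
    wp_base : hom wp_ob M;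
    wp_proj : 'I_n -> hom wp_ob E;
    wp_univ : is_wide_pullback q wp_base wp_proj }.
Arguments wp_base {X E M q n} w.
Arguments wp_proj {X E M q n} w.

Definition preserves_wp (X : category) (F : endofunctor X) (E M : X)
    (q : hom E M) (n : nat) (P : wide_pullback q n) :=
  is_wide_pullback (fmap F q) (fmap F (wp_base P)) (fun i => fmap F (wp_proj P i)).

Definition fmap_wp (X : category) (F : endofunctor X) (E M : X) (q : hom E M)
    (n : nat) (P : wide_pullback q n) (H : preserves_wp F P) :
  wide_pullback (fmap F q) n := WidePullback H.

Definition is_pullback (X : category) (A B C D : X) (top : hom A B)
    (left : hom A C) (right : hom B D) (bottom : hom C D) : Prop :=
  top ;; right = left ;; bottom /\
  forall (Y : X) (f : hom Y B) (g : hom Y C), f ;; right = g ;; bottom ->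
    exists! h : hom Y A, h ;; top = f /\ h ;; left = g.

Section Pairing.
Variables (X : category) (E M : X) (q : hom E M) (P : wide_pullback q 2).

Definition pr0 : hom P E := wp_proj P ord0.
Definition pr1 : hom P E := wp_proj P ord_max.

Definition pair_fam (Y : X) (f g : hom Y E) (i : 'I_2) : hom Y E :=
  if nat_of_ord i is 0 then f else g.

Fact pair_fam_over (Y : X) (b : hom Y M) (f g : hom Y E) :
  f ;; q = b -> g ;; q = b -> forall i, pair_fam f g i ;; q = b.
Proof. by move=> Hf Hg [[|[|//]] ?]. Qed.

(* <f, g>, for f and g lying over the same b *)
Definition pairing (Y : X) (b : hom Y M) (f g : hom Y E)
    (Hf : f ;; q = b) (Hg : g ;; q = b) : hom Y P :=
  wp_lift (wp_univ P) (pair_fam_over Hf Hg).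

Lemma pr0_over : pr0 ;; q = wp_base P.
Proof. exact: wp_comm (wp_univ P) _. Qed.
Lemma pr1_over : pr1 ;; q = wp_base P.
Proof. exact: wp_comm (wp_univ P) _. Qed.

Lemma pairing_base Y b f g Hf Hg : @pairing Y b f g Hf Hg ;; wp_base P = b.
Proof. exact: wp_lift_base. Qed.
Lemma pairing_pr0 Y b f g Hf Hg : @pairing Y b f g Hf Hg ;; pr0 = f.
Proof. exact: wp_lift_proj. Qed.
Lemma pairing_pr1 Y b f g Hf Hg : @pairing Y b f g Hf Hg ;; pr1 = g.
Proof. exact: wp_lift_proj. Qed.
Lemma pairing_unique (Y : X) (h h' : hom Y P) :
  h ;; pr0 = h' ;; pr0 -> h ;; pr1 = h' ;; pr1 -> h = h'.
Proof.
move=> e0 e1; apply: (wp_unique (wp_univ P)).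
  by rewrite -pr0_over !compA e0.
case=> -[|[|//]] i.
  by rewrite (_ : Ordinal i = ord0) //; apply: val_inj.
by rewrite (_ : Ordinal i = ord_max) //; apply: val_inj.
Qed.
End Pairing.
Arguments pr0 {X E M q} P.
Arguments pr1 {X E M q} P.

(* The data of an additive bundle, before the monoid axioms. *)
Record bundle_data (X : category) (E M : X) (q : hom E M) := BundleData {
  bpow : forall n, wide_pullback q n;
  badd : hom (bpow 2) E;
  bzero : hom M E;
  badd_over : badd ;; q = wp_base (bpow 2);
  bzero_over : bzero ;; q = idm M }.
Arguments bpow {X E M q} b.
Arguments badd {X E M q} b.
Arguments bzero {X E M q} b.

Section BundleSum.
Variables (X : category) (E M : X) (q : hom E M) (B : bundle_data q).

(* f + g := <f, g> +, for f and g lying over the same b *)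
Definition bsum (Y : X) (b : hom Y M) (f g : hom Y E)
    (Hf : f ;; q = b) (Hg : g ;; q = b) : hom Y E :=
  pairing (bpow B 2) Hf Hg ;; badd B.

Lemma bsum_over Y b f g Hf Hg : @bsum Y b f g Hf Hg ;; q = b.
Proof. by rewrite /bsum -compA badd_over pairing_base. Qed.

Lemma bzero_at_over (Y : X) (b : hom Y M) : b ;; bzero B ;; q = b.
Proof. by rewrite -compA bzero_over compm1. Qed.

Definition tri0_over : wp_proj (bpow B 3) (@Ordinal 3 0 isT) ;; q = _ :=
  wp_comm (wp_univ _) _.
Definition tri1_over : wp_proj (bpow B 3) (@Ordinal 3 1 isT) ;; q = _ :=
  wp_comm (wp_univ _) _.
Definition tri2_over : wp_proj (bpow B 3) (@Ordinal 3 2 isT) ;; q = _ :=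
  wp_comm (wp_univ _) _.

(* q is a commutative monoid in the slice over M: associativity is an equation
   between maps E_3 -> E, commutativity between maps E_2 -> E, and the unit law
   between maps E -> E. *)
Record bundle_axioms : Prop := BundleAxioms {
  baddA : bsum tri0_over (bsum_over tri1_over tri2_over) =
          bsum (bsum_over tri0_over tri1_over) tri2_over;
  baddC : bsum (pr1_over (bpow B 2)) (pr0_over (bpow B 2)) = badd B;
  badd0 : bsum (bzero_at_over q) (comp1m q) = idm E }.
End BundleSum.

Record additive_bundle (X : category) (E M : X) (q : hom E M) := AdditiveBundle {
  bundle :> bundle_data q;
  bundleP : bundle_axioms bundle }.

Section BundleMorphism.
Variables (X : category) (E M E' M' : X) (q : hom E M) (q' : hom E' M').
Variables (B : additive_bundle q) (B' : additive_bundle q').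
Variables (f1 : hom E E') (f0 : hom M M').

Fact square_over (Y : X) (b : hom Y M) (f : hom Y E) :
  f1 ;; q' = q ;; f0 -> f ;; q = b -> f ;; f1 ;; q' = b ;; f0.
Proof. by move=> e <-; rewrite -!compA e. Qed.

(* the map E_2 -> E'_2 given by <pi_0 f1, pi_1 f1> *)
Definition bundle_map2 (e : f1 ;; q' = q ;; f0) : hom (bpow B 2) (bpow B' 2) :=
  pairing (bpow B' 2) (square_over e (pr0_over (bpow B 2)))
                      (square_over e (pr1_over (bpow B 2))).

Record additive_bundle_morphism : Prop := AdditiveBundleMorphism {
  bmor_square : f1 ;; q' = q ;; f0;
  bmor_add : badd B ;; f1 = bundle_map2 bmor_square ;; badd B';
  bmor_zero : bzero B ;; f1 = f0 ;; bzero B' }.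
End BundleMorphism.

(* The image of an additive bundle under a functor preserving its wide
   pullbacks. *)
Section ImageBundle.
Variables (X : category) (F : endofunctor X) (E M : X) (q : hom E M).
Variables (B : additive_bundle q) (H : forall n, preserves_wp F (bpow B n)).

Fact image_add_over :
  fmap F (badd B) ;; fmap F q = wp_base (fmap_wp (H 2)).
Proof. by rewrite -fmapM badd_over. Qed.
Fact image_zero_over : fmap F (bzero B) ;; fmap F q = idm (F M).
Proof. by rewrite -fmapM bzero_over fmap1. Qed.

Definition image_bundle_data : bundle_data (fmap F q) :=
  @BundleData X (F E) (F M) (fmap F q) (fun n => fmap_wp (H n))
    (fmap F (badd B)) (fmap F (bzero B)) image_add_over image_zero_over.

Fact fmap_bsum (Y : X) (b : hom Y M) (f g : hom Y E)
    (Hf : f ;; q = b) (Hg : g ;; q = b) (b' : hom (F Y) (F M))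
    (f' g' : hom (F Y) (F E)) (Hf' : f' ;; fmap F q = b')
    (Hg' : g' ;; fmap F q = b') : f' = fmap F f -> g' = fmap F g ->
  bsum image_bundle_data Hf' Hg' = fmap F (bsum B Hf Hg).
Proof.
move=> ef eg; rewrite /bsum fmapM /=; congr (_ ;; _).
apply: (@pairing_unique _ _ _ _ (fmap_wp (H 2))).
  by rewrite pairing_pr0 ef /= -fmapM pairing_pr0.
by rewrite pairing_pr1 eg /= -fmapM pairing_pr1.
Qed.

Fact image_bundle_axioms : bundle_axioms image_bundle_data.
Proof.
have [A C Z] := bundleP B; split.
- rewrite (fmap_bsum (tri0_over B)
             (bsum_over B (tri1_over B) (tri2_over B))) ?A //; last first.
    exact: fmap_bsum.
  by symmetry; apply: fmap_bsum => //; apply: fmap_bsum.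
- by rewrite (fmap_bsum (pr1_over (bpow B 2)) (pr0_over (bpow B 2))) // C.
- rewrite (fmap_bsum (bzero_at_over B q) (comp1m q)) ?Z ?fmap1 //.
  by rewrite fmapM.
Qed.

Definition image_bundle : additive_bundle (fmap F q) :=
  AdditiveBundle image_bundle_axioms.
End ImageBundle.
Arguments image_bundle {X} F {E M q} B H.

(* Everything in a tangent category except the universality of the vertical
   lift, whose statement uses the other axioms. *)
Record pre_tangent (X : category) := PreTangent {
  tfun :> endofunctor X;

  tproj : forall M : X, hom (tfun M) M;
  tproj_nat : forall (M N : X) (f : hom M N),
    fmap tfun f ;; tproj N = tproj M ;; f;
  tbun : forall M : X, additive_bundle (tproj M);
  tpow_preserved : forall (k : nat) (M : X) (n : nat),
    preserves_wp (fpow tfun k) (bpow (tbun M) n);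
  tzero_nat : forall (M N : X) (f : hom M N),
    bzero (tbun M) ;; fmap tfun f = f ;; bzero (tbun N);
  tadd_nat : forall (M N : X) (f : hom M N),
    badd (tbun M) ;; fmap tfun f =
    bundle_map2 (tbun M) (tbun N) (tproj_nat f) ;; badd (tbun N);

  tlift : forall M : X, hom (tfun M) (tfun (tfun M));
  tlift_nat : forall (M N : X) (f : hom M N),
    fmap tfun f ;; tlift N = tlift M ;; fmap tfun (fmap tfun f);
  tflip : forall M : X, hom (tfun (tfun M)) (tfun (tfun M));
  tflip_nat : forall (M N : X) (f : hom M N),
    fmap tfun (fmap tfun f) ;; tflip N = tflip M ;; fmap tfun (fmap tfun f);

  (* (T(p), T(+), T(0)); note that [fpow tfun 1] is convertible to [tfun] *)
  Tbun : forall M : X, additive_bundle (fmap tfun (tproj M)) :=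
    fun M => image_bundle tfun (tbun M) (tpow_preserved 1 M);
  tlift_additive : forall M : X,
    additive_bundle_morphism (tbun M) (Tbun M) (tlift M) (bzero (tbun M));
  tflip_additive : forall M : X,
    additive_bundle_morphism (Tbun M) (tbun (tfun M)) (tflip M) (idm (tfun M));

  tflipK : forall M : X, tflip M ;; tflip M = idm (tfun (tfun M));
  tlift_flip : forall M : X, tlift M ;; tflip M = tlift M;
  tlift_lift : forall M : X,
    tlift M ;; tlift (tfun M) = tlift M ;; fmap tfun (tlift M);
  tflip_braid : forall M : X,
    fmap tfun (tflip M) ;; tflip (tfun M) ;; fmap tfun (tflip M) =
    tflip (tfun M) ;; fmap tfun (tflip M) ;; tflip (tfun M);
  tlift_braid : forall M : X,
    tlift (tfun M) ;; fmap tfun (tflip M) ;; tflip (tfun M) =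
    tflip M ;; fmap tfun (tlift M) }.
Arguments tproj {X} p M.
Arguments tbun {X} p M.
Arguments tlift {X} p M.
Arguments tflip {X} p M.
Arguments Tbun {X} p M.

Definition tzero (X : category) (T : pre_tangent X) (M : X) : hom M (T M) :=
  bzero (tbun T M).

Section VerticalLift.
Variables (X : category) (T : pre_tangent X) (M : X).

Notation T2M := (bpow (tbun T M) 2).

Fact vlift0_over :
  pr0 T2M ;; tlift T M ;; fmap T (tproj T M) = wp_base T2M ;; tzero T M.
Proof. exact: square_over (bmor_square (tlift_additive _ M)) (pr0_over _). Qed.

Fact vlift1_over :
  pr1 T2M ;; tzero T (T M) ;; fmap T (tproj T M) = wp_base T2M ;; tzero T M.
Proof. exact: square_over (tzero_nat T (tproj T M)) (pr1_over _). Qed.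

(* <pi_0 l, pi_1 0> T(+) : T_2 M -> T^2 M *)
Definition vertical_lift : hom T2M (T (T M)) :=
  bsum (Tbun T M) vlift0_over vlift1_over.
End VerticalLift.

Record tangent_structure (X : category) := TangentStructure {
  tpre :> pre_tangent X;
  tvertical_universal : forall (M : X) (k : nat),
    is_pullback (fmap (fpow tpre k) (vertical_lift tpre M))
                (fmap (fpow tpre k) (wp_base (bpow (tbun tpre M) 2)))
                (fmap (fpow tpre k) (fmap tpre (tproj tpre M)))
                (fmap (fpow tpre k) (tzero tpre M)) }.

Section FibrewiseSum.
Variables (X : category) (T : tangent_structure X).

Definition tsum (Y M : X) (b : hom Y M) (f g : hom Y (T M))
    (Hf : f ;; tproj T M = b) (Hg : g ;; tproj T M = b) : hom Y (T M) :=
  bsum (tbun T M) Hf Hg.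

Lemma tsum_over Y M b f g Hf Hg : @tsum Y M b f g Hf Hg ;; tproj T M = b.
Proof. exact: bsum_over. Qed.
End FibrewiseSum.
Arguments tsum {X T Y M b} f g Hf Hg.

Record negatives (X : category) (T : tangent_structure X) := Negatives {
  tneg : forall M : X, hom (T M) (T M);
  tneg_nat : forall (M N : X) (f : hom M N),
    fmap T f ;; tneg N = tneg M ;; fmap T f;
  tneg_over : forall M : X, tneg M ;; tproj T M = tproj T M;
  tnegP : forall M : X,
    tsum (idm (T M)) (tneg M) (comp1m _) (tneg_over M) = tproj T M ;; tzero T M }.
Arguments tneg {X T} n M.

Section Curvature.
Variables (X : category) (T : tangent_structure X) (N : negatives T) (M : X).

Fact opp_over (Y : X) (b : hom Y M) (f : hom Y (T M)) :
  f ;; tproj T M = b -> f ;; tneg N M ;; tproj T M = b.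
Proof. by rewrite -compA tneg_over. Qed.

(* f - g := <f, g n> + *)
Definition tsub (Y : X) (b : hom Y M) (f g : hom Y (T M))
    (Hf : f ;; tproj T M = b) (Hg : g ;; tproj T M = b) : hom Y (T M) :=
  tsum f (g ;; tneg N M) Hf (opp_over Hg).

Record vertical_connection (K : hom (T (T M)) (T M)) : Prop :=
  VerticalConnection {
    vc_retract : tlift T M ;; K = idm (T M);
    vc_over : K ;; tproj T M = tproj T (T M) ;; tproj T M;
    vc_linear_p : K ;; tlift T M = tlift T (T M) ;; fmap T K;
    vc_linear_Tp :
      K ;; tlift T M = fmap T (tlift T M) ;; tflip T (T M) ;; fmap T K }.

Definition torsion_free (K : hom (T (T M)) (T M)) : Prop := tflip T M ;; K = K.

Arguments tsub {Y b} f g Hf Hg.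

(* the iterated projections T^3 M -> M and T^4 M -> M *)
Definition proj3 : hom (T (T (T M))) M :=
  tproj T (T (T M)) ;; tproj T (T M) ;; tproj T M.
Definition proj4 : hom (T (T (T (T M)))) M :=
  tproj T (T (T (T M))) ;; tproj T (T (T M)) ;; tproj T (T M) ;; tproj T M.

Lemma flip_proj (Y : X) : tflip T Y ;; tproj T (T Y) = fmap T (tproj T Y).
Proof. by rewrite (bmor_square (tflip_additive T Y)) compm1. Qed.

Lemma flip_proj2 (Y : X) :
  tflip T Y ;; tproj T (T Y) ;; tproj T Y = tproj T (T Y) ;; tproj T Y.
Proof. by rewrite flip_proj tproj_nat. Qed.

Lemma flip_proj3 : tflip T (T M) ;; proj3 = proj3.
Proof. by rewrite /proj3 !compA flip_proj2. Qed.

Lemma Tflip_proj3 : fmap T (tflip T M) ;; proj3 = proj3.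
Proof.
by rewrite /proj3 !compA tproj_nat -!compA; congr (_ ;; _); rewrite compA flip_proj2.
Qed.

Lemma Tflip_proj4 : fmap T (tflip T (T M)) ;; proj4 = proj4.
Proof.
rewrite /proj4 !compA tproj_nat -!compA; congr (_ ;; _).
by have := flip_proj3; rewrite /proj3 -!compA.
Qed.

Lemma TTflip_proj4 : fmap T (fmap T (tflip T M)) ;; proj4 = proj4.
Proof.
rewrite /proj4 !compA tproj_nat -!compA; congr (_ ;; _).
by have := Tflip_proj3; rewrite /proj3 -!compA.
Qed.

Section Connection.
Variables (K : hom (T (T M)) (T M)) (HK : vertical_connection K).

Lemma TKK_over : fmap T K ;; K ;; tproj T M = proj3.
Proof.
by rewrite -compA (vc_over HK) compA tproj_nat -compA (vc_over HK) compA.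
Qed.

Lemma flip_TKK_over : tflip T (T M) ;; fmap T K ;; K ;; tproj T M = proj3.
Proof. by rewrite -!compA (compA (fmap T K)) TKK_over flip_proj3. Qed.

Definition curvature : hom (T (T (T M))) (T M) :=
  tsub (tflip T (T M) ;; fmap T K ;; K) (fmap T K ;; K) flip_TKK_over TKK_over.

Lemma curvature_over : curvature ;; tproj T M = proj3.
Proof. exact: tsum_over. Qed.

Lemma flip_Tflip_curvature_over :
  tflip T (T M) ;; fmap T (tflip T M) ;; curvature ;; tproj T M = proj3.
Proof. by rewrite -compA curvature_over -compA Tflip_proj3 flip_proj3. Qed.

Lemma Tflip_flip_curvature_over :
  fmap T (tflip T M) ;; tflip T (T M) ;; curvature ;; tproj T M = proj3.
Proof. by rewrite -compA curvature_over -compA flip_proj3 Tflip_proj3. Qed.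

Definition dcurvature : hom (T (T (T (T M)))) (T M) := fmap T curvature ;; K.

Lemma dcurvature_over : dcurvature ;; tproj T M = proj4.
Proof.
rewrite /dcurvature -compA (vc_over HK) compA tproj_nat -compA curvature_over.
by rewrite /proj3 /proj4 !compA.
Qed.

Lemma Tflip_TTflip_dcurvature_over :
  fmap T (tflip T (T M)) ;; fmap T (fmap T (tflip T M)) ;; dcurvature
    ;; tproj T M = proj4.
Proof. by rewrite -compA dcurvature_over -compA TTflip_proj4 Tflip_proj4. Qed.

Lemma TTflip_Tflip_dcurvature_over :
  fmap T (fmap T (tflip T M)) ;; fmap T (tflip T (T M)) ;; dcurvature
    ;; tproj T M = proj4.
Proof. by rewrite -compA dcurvature_over -compA Tflip_proj4 TTflip_proj4. Qed.
End Connection.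
End Curvature.

Arguments curvature {X T} N {M K} HK.
Arguments dcurvature {X T} N {M K} HK.
Arguments proj3 {X} T M.
Arguments proj4 {X} T M.

(* Main.v *)
From mathcomp Require Import all_boot.
Require Import Defs.

Set Implicit Arguments.
Unset Strict Implicit.
Unset Printing Implicit Defensive.

(** Write sums in the fibres of [tproj T M] and put A := T(K) K : T^3 M -> TM,
    s := c_{TM}, r := T(c_M).  Torsion-freeness gives r A = A, and C is
    the difference s A - A of two terms that s exchanges; this is anti-symmetry.

    For the first Bianchi identity, expand all three terms: they are
    differences of A, s A and r s A, because r A = A, s s = 1 and
    s r s = r s r.  So
      C = s A - A,   s r C = r s A - s A,   r s C = A - r s A,
    and the sum telescopes ([cyclic_sum_zero]).

    The second Bianchi identity is the same computation one level up.  Since K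
    carries T(p)-sums to p-sums ([connection_Tadditive]), applying T(-) K to
    C + A = s A gives D_K(C) = T(s) B - B with B := T(A) K, and the images under
    T of the relations above turn B, T(s), T(r) into another instance of
    [cyclic_sum_zero].

    Additivity of K comes from its linearity: the lift of TM is additive from p
    to p (by [tlift_flip] it does not matter which of the two sums of T^2 M is
    used) and monic, being a section of K, while K ; lift = lift ; T(K) with
    T(K) additive by naturality. *)

(** * Sums of generalised elements of an additive bundle *)

Section BundleSums.
Variables (X : category) (E M : X) (q : hom E M) (B : additive_bundle q).

(** [bsum] takes proofs that its summands lie over a common base, and homs are
    arbitrary types; uniqueness of maps into the pullback makes the sum
    independent of these proofs without proof irrelevance. *)
Lemma eq_bsum (Y : X) (b b' : hom Y M) (f g f' g' : hom Y E)
    (Hf : f ;; q = b) (Hg : g ;; q = b) (Hf' : f' ;; q = b') (Hg' : g' ;; q = b') :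
  f = f' -> g = g' -> bsum B Hf Hg = bsum B Hf' Hg'.
Proof.
move=> ef eg; rewrite /bsum; congr (_ ;; _).
by apply: pairing_unique; rewrite ?pairing_pr0 ?pairing_pr1.
Qed.

Lemma comp_bsum (Z Y : X) (h : hom Z Y) (b : hom Y M) (b' : hom Z M)
    (f g : hom Y E) (Hf : f ;; q = b) (Hg : g ;; q = b)
    (Hf' : h ;; f ;; q = b') (Hg' : h ;; g ;; q = b') :
  h ;; bsum B Hf Hg = bsum B Hf' Hg'.
Proof.
rewrite /bsum compA; congr (_ ;; _).
by apply: pairing_unique; rewrite -compA ?pairing_pr0 ?pairing_pr1.
Qed.

Lemma comp_over (Z Y : X) (h : hom Z Y) (b : hom Y M) (f : hom Y E) :
  f ;; q = b -> h ;; f ;; q = h ;; b.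
Proof. by move=> <-; rewrite compA. Qed.

Lemma bsumC (Y : X) (b : hom Y M) (f g : hom Y E)
    (Hf : f ;; q = b) (Hg : g ;; q = b) : bsum B Hf Hg = bsum B Hg Hf.
Proof.
have H := baddC (bundleP B).
rewrite {1}/bsum -H (comp_bsum _ _
  (comp_over (pairing (bpow B 2) Hf Hg) (pr1_over (bpow B 2)))
  (comp_over (pairing (bpow B 2) Hf Hg) (pr0_over (bpow B 2)))).
by apply: eq_bsum; rewrite ?pairing_pr0 ?pairing_pr1.
Qed.

Lemma bsumA (Y : X) (b : hom Y M) (f g h : hom Y E)
    (Hf : f ;; q = b) (Hg : g ;; q = b) (Hh : h ;; q = b)
    (Hgh : bsum B Hg Hh ;; q = b) (Hfg : bsum B Hf Hg ;; q = b) :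
  bsum B Hf Hgh = bsum B Hfg Hh.
Proof.
(* the axiom equates two maps out of E_3: precompose it with <f, g, h> *)
pose F (i : 'I_3) := match nat_of_ord i with 0 => f | 1 => g | _ => h end.
have HF i : F i ;; q = b by case: i => -[|[|[|//]]].
pose t := wp_lift (wp_univ (bpow B 3)) HF.
have Ht := wp_lift_proj (wp_univ (bpow B 3)) HF.
have t0 : t ;; wp_proj (bpow B 3) (@Ordinal 3 0 isT) = f by rewrite Ht.
have t1 : t ;; wp_proj (bpow B 3) (@Ordinal 3 1 isT) = g by rewrite Ht.
have t2 : t ;; wp_proj (bpow B 3) (@Ordinal 3 2 isT) = h by rewrite Ht.
have := congr1 (fun x => t ;; x) (baddA (bundleP B)).
set l := (X in X = _); set r := (X in _ = X).
have -> : l = bsum B Hf Hgh.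
  rewrite /l (comp_bsum _ _ (comp_over _ (tri0_over B))
    (comp_over _ (bsum_over B (tri1_over B) (tri2_over B)))).
  apply: eq_bsum => //; rewrite (comp_bsum _ _ (comp_over _ (tri1_over B))
    (comp_over _ (tri2_over B))).
  exact: eq_bsum.
have -> // : r = bsum B Hfg Hh.
rewrite /r (comp_bsum _ _
  (comp_over _ (bsum_over B (tri0_over B) (tri1_over B)))
  (comp_over _ (tri2_over B))).
apply: eq_bsum => //; rewrite (comp_bsum _ _ (comp_over _ (tri0_over B))
  (comp_over _ (tri1_over B))).
exact: eq_bsum.
Qed.

Lemma bsum0 (Y : X) (b : hom Y M) (f : hom Y E)
    (H0 : b ;; bzero B ;; q = b) (Hf : f ;; q = b) : bsum B H0 Hf = f.
Proof.
rewrite -[RHS]compm1 -(badd0 (bundleP B)) (comp_bsum _ _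
  (comp_over f (bzero_at_over B q)) (comp_over f (comp1m q))).
by apply: eq_bsum; rewrite ?compm1 // compA Hf.
Qed.
End BundleSums.
Arguments comp_bsum {X E M q B Z Y h b b' f g}.

Lemma additive_bsum (X : category) (E M E' M' : X) (q : hom E M)
    (q' : hom E' M') (B : additive_bundle q) (B' : additive_bundle q')
    (f1 : hom E E') (f0 : hom M M')
    (Hm : additive_bundle_morphism B B' f1 f0) (Y : X)
    (b : hom Y M) (b' : hom Y M') (f g : hom Y E)
    (Hf : f ;; q = b) (Hg : g ;; q = b)
    (Hf' : f ;; f1 ;; q' = b') (Hg' : g ;; f1 ;; q' = b') :
  bsum B Hf Hg ;; f1 = bsum B' Hf' Hg'.
Proof.
case: Hm => sq Hadd _; rewrite /bsum -compA Hadd compA; congr (_ ;; _).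
by apply: pairing_unique; rewrite -compA /bundle_map2 ?pairing_pr0 ?pairing_pr1
  compA ?pairing_pr0 ?pairing_pr1.
Qed.

(** * Cancellation in the fibres of the tangent bundle *)

Section Cancellation.
Variables (X : category) (T : tangent_structure X) (N : negatives T) (M Y : X).
Variable b : hom Y M.

Lemma neg_tsum (f : hom Y (T M)) (Hn : f ;; tneg N M ;; tproj T M = b)
    (Hf : f ;; tproj T M = b) : tsum (f ;; tneg N M) f Hn Hf = b ;; tzero T M.
Proof.
rewrite /tsum bsumC.
have -> : b ;; tzero T M = f ;; (tproj T M ;; tzero T M) by rewrite compA Hf.
rewrite -(tnegP N) /tsum.
rewrite (comp_bsum _ _ (comp_over f (comp1m _)) (comp_over f (tneg_over N M))).
by apply: eq_bsum; rewrite ?compm1.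
Qed.

Lemma tzero_over : b ;; tzero T M ;; tproj T M = b.
Proof. exact: bzero_at_over. Qed.

(** The curvature is used only through the equation C + A = s A; [Hg'] keeps
    the statement applicable whatever proof is supplied for A. *)
Lemma tsum_subK (f g : hom Y (T M)) (Hf : f ;; tproj T M = b)
    (Hg Hg' : g ;; tproj T M = b) (Hd : tsub N Hf Hg ;; tproj T M = b) :
  tsum (tsub N Hf Hg) g Hd Hg' = f.
Proof.
rewrite /tsum -(bsumA (bsum_over _ (opp_over N Hg) Hg') _) bsumC.
rewrite -[RHS](bsum0 tzero_over Hf).
by apply: eq_bsum => //; apply: neg_tsum.
Qed.

Lemma tsum_cancel (x y z : hom Y (T M)) (Hx : x ;; tproj T M = b)
    (Hy : y ;; tproj T M = b) (Hz : z ;; tproj T M = b) :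
  tsum x z Hx Hz = tsum y z Hy Hz -> x = y.
Proof.
have cancel w (Hw : w ;; tproj T M = b) :
    tsum (z ;; tneg N M) (tsum z w Hz Hw) (opp_over N Hz) (tsum_over Hz Hw) = w.
  rewrite /tsum (bsumA _ (bsum_over _ (opp_over N Hz) Hz)).
  rewrite -[RHS](bsum0 tzero_over Hw).
  by apply: eq_bsum => //; apply: neg_tsum.
move=> e; rewrite -[x](cancel _ Hx) -[y](cancel _ Hy).
by apply: eq_bsum => //; rewrite /tsum bsumC [RHS]bsumC.
Qed.
End Cancellation.

(** * Differences under two braided involutions *)

Section Differences.
Variables (X : category) (T : tangent_structure X) (N : negatives T) (M Z : X).
Variables (b : hom Z M) (s : hom Z Z) (a d : hom Z (T M)).
Hypothesis (Ha : a ;; tproj T M = b) (Hd : d ;; tproj T M = b).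
Hypothesis ss : s ;; s = idm Z.
Hypothesis d_def : tsum d a Hd Ha = s ;; a.

Let Hsa : s ;; a ;; tproj T M = b.
Proof. by rewrite -d_def; apply: tsum_over. Qed.

(** s exchanges the two terms of d = s a - a, so it negates d. *)
Lemma swap_difference : s ;; b = b -> s ;; d = d ;; tneg N M.
Proof.
move=> sb.
have Hsd : s ;; d ;; tproj T M = b by rewrite -compA Hd.
(* both sides added to s a give a *)
apply: (tsum_cancel N (Hx := Hsd) (Hy := opp_over N Hd) (Hz := Hsa)).
have -> : tsum (s ;; d) (s ;; a) Hsd Hsa = a.
  by rewrite /tsum -(comp_bsum Hd Ha) [bsum _ _ _]d_def compA ss comp1m.
transitivity (tsum (d ;; tneg N M) (tsum d a Hd Ha)
                   (opp_over N Hd) (tsum_over Hd Ha)); last exact: eq_bsum.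
rewrite /tsum (bsumA _ (bsum_over _ (opp_over N Hd) Hd)).
rewrite -[LHS](bsum0 (tzero_over T b) Ha).
by apply: eq_bsum => //; rewrite [RHS]neg_tsum.
Qed.

(** With x = a, y = s a, z = r s a, the hypotheses make the three summands
    y - x, z - y and x - z. *)
Lemma cyclic_sum_zero (r : hom Z Z)
    (srs : r ;; s ;; r = s ;; r ;; s) (ra : r ;; a = a)
    (Hsrd : s ;; r ;; d ;; tproj T M = b) (Hrsd : r ;; s ;; d ;; tproj T M = b)
    (Hsum : tsum d (s ;; r ;; d) Hd Hsrd ;; tproj T M = b) :
  tsum (tsum d (s ;; r ;; d) Hd Hsrd) (r ;; s ;; d) Hsum Hrsd = b ;; tzero T M.
Proof.
have sra : s ;; r ;; a = s ;; a by rewrite -compA ra.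
have Hsra : s ;; r ;; a ;; tproj T M = b by rewrite sra.
have srd_def : tsum (s ;; r ;; d) (s ;; a) Hsrd Hsa = r ;; s ;; a.
  have -> : r ;; s ;; a = s ;; r ;; (s ;; a).
    by rewrite compA -srs -!compA ra.
  rewrite -[X in _ = _ ;; X]d_def /tsum (comp_bsum _ _ Hsrd Hsra).
  exact: eq_bsum.
have Hrsa : r ;; s ;; a ;; tproj T M = b by rewrite -srd_def; apply: tsum_over.
have rsd_def : tsum (r ;; s ;; d) (r ;; s ;; a) Hrsd Hrsa = a.
  by rewrite /tsum -(comp_bsum Hd Ha) [bsum _ _ _]d_def compA -(compA r) ss compm1.
have Hdds := tsum_over Hsum Hrsd.
apply: (tsum_cancel N (Hx := Hdds) (Hy := tzero_over T b) (Hz := Hrsa)).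
rewrite /tsum (bsum0 (tzero_over T b) Hrsa).
rewrite -(bsumA (bsum_over _ Hrsd Hrsa) _).
(* ((y - x) + (z - y)) + x, regrouped as (z - y) + ((y - x) + x) *)
transitivity (tsum _ a (tsum_over Hsrd Hd) Ha).
  by apply: eq_bsum => //; apply: bsumC.
rewrite /tsum -(bsumA (bsum_over _ Hd Ha) _) -[RHS]srd_def.
exact: eq_bsum.
Qed.
End Differences.

(** * Additivity of a torsion-free connection *)

Section Additivity.
Variables (X : category) (T : tangent_structure X).

Lemma fmap_tsum (M M' Y : X) (h : hom M M') (b : hom Y M) (b' : hom Y M')
    (f g : hom Y (T M)) (Hf : f ;; tproj T M = b) (Hg : g ;; tproj T M = b)
    (Hf' : f ;; fmap T h ;; tproj T M' = b') (Hg' : g ;; fmap T h ;; tproj T M' = b') :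
  tsum f g Hf Hg ;; fmap T h = tsum (f ;; fmap T h) (g ;; fmap T h) Hf' Hg'.
Proof.
apply: (@additive_bsum _ _ _ _ _ _ _ _ _ _ h).
exact: (AdditiveBundleMorphism (tadd_nat _ h) (tzero_nat _ h)).
Qed.

(** The axioms give additivity of the lift from p to T(p); composing with the
    flip, which exchanges the two sums and fixes the lift, turns T(p) into p. *)
Lemma tlift_tsum (M Y : X) (b : hom Y M) (b' : hom Y (T M))
    (f g : hom Y (T M)) (Hf : f ;; tproj T M = b) (Hg : g ;; tproj T M = b)
    (Hf' : f ;; tlift T M ;; tproj T (T M) = b')
    (Hg' : g ;; tlift T M ;; tproj T (T M) = b') :
  tsum f g Hf Hg ;; tlift T M = tsum (f ;; tlift T M) (g ;; tlift T M) Hf' Hg'.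
Proof.
have Hl := tlift_additive T M; have Hc := tflip_additive T M.
have over h (Hh : h ;; tproj T M = b) := square_over (bmor_square Hl) Hh.
have overc h (Hh : h ;; tproj T M = b) := square_over (bmor_square Hc) (over h Hh).
rewrite -[in LHS]tlift_flip compA (additive_bsum Hl _ _ (over _ Hf) (over _ Hg)).
rewrite (additive_bsum Hc _ _ (overc _ Hf) (overc _ Hg)).
by apply: eq_bsum; rewrite -compA tlift_flip.
Qed.

Section Connection.
Variables (M : X) (K : hom (T (T M)) (T M)) (HK : vertical_connection K).

(** K ; lift = lift ; T(K) is a composite of additive maps, and the lift is
    a section of K, so it can be cancelled. *)
Lemma connection_tsum (Y : X) (b : hom Y (T M)) (b' : hom Y M)
    (f g : hom Y (T (T M)))
    (Hf : f ;; tproj T (T M) = b) (Hg : g ;; tproj T (T M) = b)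
    (Hf' : f ;; K ;; tproj T M = b') (Hg' : g ;; K ;; tproj T M = b') :
  tsum f g Hf Hg ;; K = tsum (f ;; K) (g ;; K) Hf' Hg'.
Proof.
have tlift_inj (x y : hom Y (T M)) : x ;; tlift T M = y ;; tlift T M -> x = y.
  by move=> e; rewrite -[x]compm1 -[y]compm1 -(vc_retract HK) !compA e.
have lift_over (M' : X) (c : hom Y M') (h : hom Y (T M')) :
    h ;; tproj T M' = c -> h ;; tlift T M' ;; tproj T (T M') = c ;; tzero T M'.
  move=> Hh; rewrite -(tlift_flip T) compA -compA flip_proj.
  by have := square_over (bmor_square (tlift_additive T M')) Hh.
have eK h : h ;; K ;; tlift T M = h ;; tlift T (T M) ;; fmap T K.
  by rewrite -!compA (vc_linear_p HK).
have over h (Hh : h ;; tproj T (T M) = b) :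
    h ;; tlift T (T M) ;; fmap T K ;; tproj T (T M) = b ;; tzero T (T M) ;; K.
  by rewrite -compA tproj_nat compA (lift_over _ _ _ Hh).
apply: tlift_inj.
rewrite eK (tlift_tsum _ _ (lift_over _ _ _ Hf) (lift_over _ _ _ Hg)).
rewrite (fmap_tsum _ _ (over _ Hf) (over _ Hg)).
rewrite (tlift_tsum _ _ (lift_over _ _ _ Hf') (lift_over _ _ _ Hg')).
by apply: eq_bsum; rewrite eK.
Qed.

Hypothesis Ktf : torsion_free K.

(** The flip turns T(p)-sums into p-sums and K does not see it, by
    torsion-freeness. *)
Lemma connection_Tadditive (Y : X) (b : hom Y (T M)) (b' : hom Y M)
    (f g : hom Y (T (T M)))
    (Hf : f ;; fmap T (tproj T M) = b) (Hg : g ;; fmap T (tproj T M) = b)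
    (Hf' : f ;; K ;; tproj T M = b') (Hg' : g ;; K ;; tproj T M = b') :
  bsum (Tbun T M) Hf Hg ;; K = tsum (f ;; K) (g ;; K) Hf' Hg'.
Proof.
have Hc := tflip_additive T M.
have over h (Hh : h ;; fmap T (tproj T M) = b) := square_over (bmor_square Hc) Hh.
have eK h : h ;; tflip T M ;; K = h ;; K by rewrite -compA Ktf.
have overK h (Hh : h ;; K ;; tproj T M = b') : h ;; tflip T M ;; K ;; tproj T M = b'.
  by rewrite eK.
rewrite -eK (additive_bsum Hc _ _ (over _ Hf) (over _ Hg)).
rewrite [LHS](connection_tsum _ _ (overK _ Hf') (overK _ Hg')).
exact: eq_bsum.
Qed.

Lemma fmap_tsum_connection (Y : X) (b : hom Y M) (b' : hom (T Y) M)
    (f g : hom Y (T M)) (Hf : f ;; tproj T M = b) (Hg : g ;; tproj T M = b)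
    (Hf' : fmap T f ;; K ;; tproj T M = b') (Hg' : fmap T g ;; K ;; tproj T M = b') :
  fmap T (tsum f g Hf Hg) ;; K = tsum (fmap T f ;; K) (fmap T g ;; K) Hf' Hg'.
Proof.
have over h (Hh : h ;; tproj T M = b) : fmap T h ;; fmap T (tproj T M) = fmap T b.
  by rewrite -fmapM Hh.
rewrite -(connection_Tadditive (over _ Hf) (over _ Hg)); congr (_ ;; _).
(* [Tbun] is the image bundle along [fpow T 1], convertible to [T] *)
symmetry; exact: (@fmap_bsum _ (fpow T 1) _ _ _ (tbun T M)).
Qed.
End Connection.
End Additivity.

(** * The curvature identities *)

Theorem theorem3p34 (X : category) (T : tangent_structure X) (N : negatives T)
    (M : X) (K : hom (T (T M)) (T M))
    (HK : vertical_connection K) (Ktf : torsion_free K) :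
  let C : hom (T (T (T M))) (T M) := curvature N HK in
  let DC : hom (T (T (T (T M)))) (T M) := dcurvature N HK in
  (let c := tflip T (T M) in
   let Tc := fmap T (tflip T M) in
   c ;; C = C ;; tneg N M /\
   tsum (tsum C (c ;; Tc ;; C)
              (curvature_over N HK) (flip_Tflip_curvature_over N HK))
        (Tc ;; c ;; C)
        (tsum_over (curvature_over N HK) (flip_Tflip_curvature_over N HK))
        (Tflip_flip_curvature_over N HK)
   = proj3 T M ;; tzero T M) /\
  (let Tc := fmap T (tflip T (T M)) in
   let TTc := fmap T (fmap T (tflip T M)) in
   tsum (tsum DC (Tc ;; TTc ;; DC)
              (dcurvature_over N HK) (Tflip_TTflip_dcurvature_over N HK))
        (TTc ;; Tc ;; DC)
        (tsum_over (dcurvature_over N HK) (Tflip_TTflip_dcurvature_over N HK))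
        (TTflip_Tflip_dcurvature_over N HK)
   = proj4 T M ;; tzero T M).
Proof.
pose A := fmap T K ;; K.
have HA : A ;; tproj T M = proj3 T M := TKK_over HK.
have C_def : tsum (curvature N HK) A (curvature_over N HK) HA
             = tflip T (T M) ;; A.
  rewrite /A compA.
  exact: (tsum_subK (Hf := flip_TKK_over HK) (Hg := TKK_over HK) HA).
have flipA : fmap T (tflip T M) ;; A = A by rewrite /A compA -fmapM Ktf.
move=> C DC; split; first split.
- exact: (swap_difference N (tflipK T (T M)) C_def (flip_proj3 T M)).
- exact: (cyclic_sum_zero N (tflipK T (T M)) C_def (tflip_braid T M) flipA).
have HB : fmap T A ;; K ;; tproj T M = proj4 T M.
  rewrite -compA (vc_over HK) compA tproj_nat -compA HA.
  by rewrite /proj3 /proj4 !compA.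
have DC_def : tsum DC (fmap T A ;; K) (dcurvature_over N HK) HB
              = fmap T (tflip T (T M)) ;; (fmap T A ;; K).
  rewrite compA -fmapM -C_def.
  by rewrite (fmap_tsum_connection HK Ktf _ _ (dcurvature_over N HK) HB).
apply: (cyclic_sum_zero N _ DC_def).
- by rewrite -fmapM tflipK fmap1.
- by rewrite -!fmapM tflip_braid.
- by rewrite compA -fmapM flipA.
Qed.
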